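(* Let $E$ be an infinite-dimensional Banach space over $\mathbb{R}$ or $\mathbb{C}$, let $(x_j,x_j^* )_{j\in\mathbb{N}^*}$ be a sequence in $E\times E^*$ such that $\lVert x_u\rVert=1$ for all $u\in\mathbb{N}^*$, $x_v^*(x_u)=0$ for all $u\neq v$ in $\mathbb{N}^*$, and $x_u^*(x_u)\neq 0$ for all $u\in\mathbb{N}^*$. Let $N_t\subseteq\mathbb{N}^*$ for $t\in(0,1)$ be the sets defined in the context, and let $x:(0,1)\to E$ be the map $$x(t)=\sum_{j\in N_t}\frac{x_j}{2^j}.$$ Then $\mathrm{Range}(x)=\{x(t):t\in(0,1)\}$ is of the form $F\setminus C$, where $F\subseteq E$ is closed and $C$ is countable; more precisely, $\overline{\mathrm{Range}(x)}\setminus \mathrm{Range}(x)$ is countable. In particular, $\mathrm{Range}(x)$ is a Borel measurable subset of $E$.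
   Context: $\mathbb{N}^*=\{1,2,3,\dots\}$, $\mathcal{P}$ is the set of prime numbers, and $E^*$ is the topological dual of $E$. ''Countable'' means finite or countably infinite. For $t\in(0,1)$ and $j\in\mathbb{N}^*$ define $$e_j(t)=\max\{p\in\mathcal{P}: p\le t^{-j}\}\ \text{ if } t^{-j}\ge 2,\qquad e_j(t)=2\ \text{ if } t^{-j}<2,$$ $$f_j(t)=\prod_{i=1}^{j}e_i(t),\qquad N_t=\{f_j(t): j\in\mathbb{N}^*\}\subseteq\mathbb{N}^*.$$ The closure $\overline{\mathrm{Range}(x)}$ is taken in the norm topology of $E$. *)

(* Defs.v *)
From HB Require Import structures.
From mathcomp Require Import all_boot all_order all_algebra.
From mathcomp Require Import complex.
From mathcomp Require Import all_classical all_reals all_analysis.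

Set Implicit Arguments.
Unset Strict Implicit.
Unset Printing Implicit Defensive.

Import Order.TTheory GRing.Theory Num.Theory.
Import numFieldNormedType.Exports.

Local Open Scope classical_set_scope.
Local Open Scope ring_scope.

Variant scalar_kind := RealScalars | ComplexScalars.

Definition scalars (R : realType) (k : scalar_kind) : numFieldType :=
  match k with
  | RealScalars => R
  | ComplexScalars => R[i]
  end.

Definition infinite_dimensional (K : numFieldType) (E : lmodType K) : Prop :=
  ~ exists (n : nat) (v : 'I_n -> E),
      forall y : E, exists c : 'I_n -> K, y = \sum_(i < n) c i *: v i.

(* The truncation only bounds the search: every p with p <= t ^- j is at most
   Num.truncn (t ^- j). The maximum is over a nonempty set when 2 <= t ^- j. *)
Definition e_ (R : realType) (j : nat) (t : R) : nat :=
  if 2 <= t ^- j then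
    (\max_(p < (Num.truncn (t ^- j)).+1 | prime p && (p%:R <= t ^- j)%R) p)%N
  else 2%N.

Definition f_ (R : realType) (j : nat) (t : R) : nat :=
  (\prod_(1 <= i < j.+1) e_ i t)%N.

Definition N_ (R : realType) (t : R) : set nat :=
  [set f_ j t | j in [set j : nat | (0 < j)%N]].

(* The sum of x_j / 2 ^ j over j in A, as the limit of its partial sums in
   increasing order of j. It converges absolutely in a Banach space when the
   x_j, j in A, are unit vectors. *)
Definition dyadic_sum (K : numFieldType) (E : normedModType K)
    (x : nat -> E) (A : set nat) : E :=
  limn (series (fun j : nat => if j \in A then 2 ^- j *: x j else 0)).

Definition borel_set (T : topologicalType) (A : set T) : Prop :=
  <<s [set U : set T | open U] >> A.

(* Main.v *)
Require Import Defs.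
From HB Require Import structures.
From mathcomp Require Import all_boot all_order all_algebra.
From mathcomp Require Import complex zify.
From mathcomp Require Import all_classical all_reals all_analysis.
Import Order.TTheory GRing.Theory Num.Theory.
Import numFieldNormedType.Exports.
Local Open Scope classical_set_scope.
Local Open Scope ring_scope.

(** The closure of the range of [f t = dyadic_sum x (N_ t)] gains only countably
    many points because [f] is a regulated function whose left limits are its own
    values and whose right limits are its own values outside a countable set.

    The map sending a set [A] of indices to [dyadic_sum x A] is continuous for the
    product topology on sets: two sets that agree up to [n] have sums at distance
    of order [2 ^- n] ([cvg_dyadic_sum]). Moreover, whether [n] belongs to [N_ t]
    depends on finitely many of the integers [e_ j t], since a product of [j]
    factors at least 2 exceeds [j] ([near_partial_products]). Hence [f] converges
    along any filter along which each [e_ j] is eventually constant.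

    Now [e_ j t] depends only on the integer part of [t ^- j]. The latter is
    continuous and nonincreasing in [t], so its integer part is left continuous,
    has a right limit everywhere, and is right continuous at [t0] unless
    [t0 ^- j] is an integer. The points [t0] for which this happens for some
    [j > 0] form the countable set [jump_points]. At [0], the first factor [e_ 1]
    tends to infinity, so [N_ t] leaves every finite set and [f] tends to 0.

    By compactness of [[0, 1]], an adherent point of the range of a regulated
    function on [(0, 1)] is a value or a one-sided limit
    ([closure_image_regulated]). An adherent point outside the range is therefore
    [f 1] (the left limit at 1), or 0 (the right limit at 0), or the right limit
    at a jump point. The range is its closure minus this countable set, and
    countable subsets of a Hausdorff space are Borel. *)

(** * Sums over dyadic weights *)

(** The archimedean property in the form that makes dyadic series converge; it
    makes sense for the partially ordered complex scalars as well. *)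
Definition dyadic_null (K : numFieldType) : Prop :=
  forall e : K, 0 < e -> exists n : nat, 2 ^- n < e.

Lemma realType_dyadic_null (R : realType) : dyadic_null R.
Proof.
move=> e e0; exists (Num.truncn e^-1).
have H : e^-1 < 2 ^+ Num.truncn e^-1.
  apply: lt_le_trans (truncnS_gt _) _.
  by rewrite -natrX ler_nat; apply: ltn_expl.
by rewrite invf_plt// posrE exprn_gt0.
Qed.

(** A positive complex number is a positive real number, so the complex case
    reduces to the real one. *)
Lemma scalars_dyadic_null (R : realType) (k : scalar_kind) :
  dyadic_null (scalars R k).
Proof.
case: k => /=; first exact: realType_dyadic_null.
move=> [a b]; rewrite ltcE /= => /andP[/eqP b0 a0].
have [n na] := realType_dyadic_null R a a0; exists n.
have -> : (2 ^- n : R[i]) = ((2 ^- n : R)%:C)%C.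
  by rewrite rmorphV ?rmorphXn ?rmorph_nat// unitfE expf_neq0.
by rewrite ltcE /= b0 eqxx.
Qed.

(** The uniform geometric bound is the source of both convergence and continuity.
    The induction proves the sharper bound with the geometric remainder
    [c * 2 ^- m *+ 2] subtracted. *)
Lemma norm_sum_dyadic (K : numFieldType) (E : normedModType K) (u : nat -> E)
    (c : K) (n m : nat) :
  (forall j, (n <= j)%N -> `|u j| <= c * 2 ^- j) ->
  `|\sum_(n <= j < m) u j| <= c * 2 ^- n *+ 2.
Proof.
move=> u_le; have c0 : 0 <= c.
  have := le_trans (normr_ge0 _) (u_le n (leqnn n)).
  by rewrite pmulr_lge0// invr_gt0 exprn_gt0.
have [mn|nm] := leqP m n.
  by rewrite big_geq// normr0 mulrn_wge0// mulr_ge0// invr_ge0 exprn_ge0.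
suff: `|\sum_(n <= j < m) u j| <= c * 2 ^- n *+ 2 - c * 2 ^- m *+ 2.
  by move/le_trans; apply; rewrite gerBl mulrn_wge0// mulr_ge0.
rewrite -(subnKC (ltnW nm)); elim: (m - n)%N => [|d IH].
  by rewrite addn0 big_geq// normr0 subrr.
rewrite addnS big_nat_recr ?leq_addr//=.
apply: le_trans (ler_normD _ _) _.
apply: le_trans (lerD IH (u_le _ (leq_addr _ _))) _.
have -> : c * 2 ^- (n + d).+1 *+ 2 = c * 2 ^- (n + d).
  by rewrite exprS invfM mulrCA -mulr_natl mulVKf.
by rewrite -addrA lerD2l mulr2n opprD -addrA addNr addr0.
Qed.

Definition dyadic_term (K : numFieldType) (E : normedModType K) (x : nat -> E)
    (A : set nat) (j : nat) : E := if j \in A then 2 ^- j *: x j else 0.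
Arguments dyadic_term {K E}.

Lemma norm_dyadic_term (K : numFieldType) (E : normedModType K) (x : nat -> E)
    (A : set nat) (j : nat) :
  (forall u, (0 < u)%N -> `|x u| = 1) -> (0 < j)%N ->
  `|dyadic_term x A j| <= 2 ^- j.
Proof.
move=> x1 j0; rewrite /dyadic_term; case: ifP => _.
  by rewrite normrZ x1// mulr1 ger0_norm// invr_ge0 exprn_ge0.
by rewrite normr0 invr_ge0 exprn_ge0.
Qed.

Lemma dyadic_sum_is_cvg (K : numFieldType) (E : completeNormedModType K)
    (x : nat -> E) (A : set nat) :
  dyadic_null K -> (forall u, (0 < u)%N -> `|x u| = 1) ->
  cvgn (series (dyadic_term x A)).
Proof.
move=> null x1; apply/cauchy_cvgP/cauchyP => e e0.
have [n ne] := null (e / 2) (divr_gt0 e0 (ltr0n _ 2)).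
exists (series (dyadic_term x A) n.+1); exists n.+1 => // m /= nm.
rewrite -ball_normE /= distrC sub_series_geq//.
apply: le_lt_trans (@norm_sum_dyadic _ _ _ 1 _ _ _) _.
  move=> j nj; rewrite mul1r; apply: norm_dyadic_term => //.
  exact: leq_trans nj.
rewrite mul1r exprS invfM -[X in X < _]mulr_natr mulrAC mulVf// mul1r.
apply: lt_trans ne _.
by rewrite ltr_pdivrMr// ltr_pMr// ltr1n.
Qed.

(** If the sets agree up to [n], the difference of the two series starts at index
    [n + 1], and its terms have norm at most [2 * 2 ^- j]. The slack [e] pays for
    the passage to the limit. *)
Lemma dyadic_sum_close (K : numFieldType) (E : completeNormedModType K)
    (x : nat -> E) (A B : set nat) (n : nat) (e : K) :
  dyadic_null K -> (forall u, (0 < u)%N -> `|x u| = 1) ->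
  (forall j, (j <= n)%N -> A j <-> B j) -> 0 < e ->
  `|dyadic_sum x A - dyadic_sum x B| < 2 ^- n *+ 2 + e.
Proof.
move=> null x1 AB e0.
pose d := series (fun j => dyadic_term x A j - dyadic_term x B j).
have d_cvg : d @ \oo --> dyadic_sum x A - dyadic_sum x B.
  rewrite /d.
  have -> : series (fun j => dyadic_term x A j - dyadic_term x B j) =
     series (dyadic_term x A) - series (dyadic_term x B).
    by apply/funext => m; rewrite /series /= fctE sumrB.
  by apply: cvgB; exact: dyadic_sum_is_cvg.
have agree k : (k <= n.+1)%N ->
    \sum_(0 <= j < k) (dyadic_term x A j - dyadic_term x B j) = 0.
  move=> kn; rewrite big_nat big1// => j /andP[_ jk].
  have /AB jAB : (j <= n)%N by rewrite -ltnS; exact: leq_trans kn.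
  apply/eqP; rewrite subr_eq0; apply/eqP; congr (if _ then _ else _).
  by apply/idP/idP; rewrite !inE => /jAB.
have d_le m : `|d m| <= 2 ^- n *+ 2.
  rewrite /d /series /=; have [mn|nm] := leqP m n.+1.
    by rewrite agree// normr0 mulrn_wge0// invr_ge0 exprn_ge0.
  rewrite (big_cat_nat (n := n.+1)) ?(ltnW nm)//= agree// add0r.
  apply: le_trans (@norm_sum_dyadic _ _ _ 2 _ _ _) _; last first.
    by rewrite exprS invfM mulrA divff// mul1r.
  move=> j nj; rewrite mulr_natl mulr2n.
  apply: le_trans (ler_normB _ _) (lerD _ _); apply: norm_dyadic_term => //;
  exact: leq_trans nj.
move/cvgrPdist_lt : d_cvg => /(_ e e0) [m _ /(_ m (leqnn m))] /=.
rewrite distrC => le_e.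
have -> : dyadic_sum x A - dyadic_sum x B =
  d m - (d m - (dyadic_sum x A - dyadic_sum x B)) by rewrite subKr.
by apply: le_lt_trans (ler_normB _ _) (ler_ltD _ _).
Qed.

Lemma filter_forall_leq (T : Type) (F : set_system T) {FF : Filter F}
    (P : nat -> set T) (n : nat) :
  (forall j, \forall t \near F, P j t) ->
  \forall t \near F, forall j, (j <= n)%N -> P j t.
Proof.
move=> FP; have : \forall t \near F, forall j : 'I_n.+1, P j t.
  by apply: filter_forall => j.
by apply: filterS => t Pt j; rewrite -ltnS => jn; exact: (Pt (Ordinal jn)).
Qed.

(** Continuity of [dyadic_sum x] for pointwise convergence of sets of indices. *)
Lemma cvg_dyadic_sum (K : numFieldType) (E : completeNormedModType K)
    (x : nat -> E) (T : Type) (F : set_system T) {FF : Filter F}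
    (A : set nat) (B : T -> set nat) :
  dyadic_null K -> (forall u, (0 < u)%N -> `|x u| = 1) ->
  (forall n, \forall t \near F, A n <-> B t n) ->
  dyadic_sum x (B t) @[t --> F] --> dyadic_sum x A.
Proof.
move=> null x1 AB; apply/cvgrPdist_lt => e e0.
have e30 : 0 < e / 3 by rewrite divr_gt0.
have [n ne] := null _ e30.
apply: filterS (@filter_forall_leq _ F _ (fun j t => A j <-> B t j) n AB).
move=> t ABt.
apply: lt_trans (dyadic_sum_close _ _ x A (B t) n (e / 3) null x1 ABt e30) _.
apply: (@lt_le_trans _ _ ((e / 3) *+ 2 + e / 3)).
  by rewrite ltrD2r ltr_pMn2r.
by rewrite -mulrSr -[X in X <= _]mulr_natr divfK.
Qed.

(** * Sets of partial products *)

Definition partial_products (e : nat -> nat) : set nat :=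
  [set (\prod_(1 <= i < j.+1) e i)%N | j in [set j : nat | (0 < j)%N]].

Lemma partial_product_gt (e : nat -> nat) (j : nat) :
  (forall i, 1 < e i)%N -> (j < \prod_(1 <= i < j.+1) e i)%N.
Proof.
move=> e1; elim: j => [|j IH]; first by rewrite big_geq.
rewrite big_nat_recr//=; have := e1 j.+1.
by move: (\prod_(_ <= _ < _) _)%N IH (e j.+1) => p jp q q1; nia.
Qed.

(** A partial product equal to [n] has fewer than [n] factors, so the first [n]
    factors decide whether [n] is a partial product. *)
Lemma sub_partial_products (e e' : nat -> nat) (n : nat) :
  (forall i, 1 < e i)%N -> (forall i, (i <= n)%N -> e i = e' i) ->
  partial_products e n -> partial_products e' n.
Proof.
move=> e1 ee' [j /= j0 jn]; exists j => //=; rewrite -[RHS]jn.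
apply: eq_big_nat => i /andP[_ ij]; rewrite ee'//.
by have := partial_product_gt _ j e1; rewrite jn; move: ij; lia.
Qed.

Lemma near_partial_products (T : Type) (F : set_system T) {FF : ProperFilter F}
    (e : T -> nat -> nat) (c : nat -> nat) (n : nat) :
  (forall t i, 1 < e t i)%N -> (forall i, \forall t \near F, e t i = c i) ->
  \forall t \near F, partial_products c n <-> partial_products (e t) n.
Proof.
move=> e1 ec; have c1 i : (1 < c i)%N.
  by have [t <-] := filter_ex (ec i).
apply: filterS (@filter_forall_leq _ F _ (fun i t => e t i = c i) n ec).
move=> t etc; split; apply: sub_partial_products => // i /etc//.
Qed.

(** * The functions e_j *)

Lemma e_gt1 (R : realType) (t : R) (j : nat) : (1 < e_ j t)%N.
Proof.
rewrite /e_; case: ifP => // t2.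
have t2' : (2 < (Num.truncn (t ^- j)).+1)%N
  by rewrite ltnS truncn_ge_nat// (le_trans _ t2).
by apply: (bigop.bigmax_sup (Ordinal t2')) => //=; rewrite t2.
Qed.

Lemma e_prime_le (R : realType) (t : R) (j p : nat) :
  prime p -> p%:R <= t ^- j -> (p <= e_ j t)%N.
Proof.
move=> pp pt; have p2 : (2 <= p%:R :> R) by rewrite ler_nat prime_gt1.
rewrite /e_ (le_trans p2 pt).
have pt' : (p < (Num.truncn (t ^- j)).+1)%N
  by rewrite ltnS truncn_ge_nat// (le_trans _ pt).
by apply: (bigop.bigmax_sup (Ordinal pt')) => //=; rewrite pp.
Qed.

(** An integer is at most [t ^- j] if and only if it is at most its integer part. *)
Lemma e_truncn (R : realType) (t s : R) (j : nat) : 0 < t -> 0 < s ->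
  Num.truncn (t ^- j) = Num.truncn (s ^- j) -> e_ j t = e_ j s.
Proof.
move=> t0 s0 ts.
have le_ts n : (n%:R <= t ^- j) = (n%:R <= s ^- j).
  by rewrite -!truncn_ge_nat ?ts// invr_ge0 exprn_ge0// ltW.
rewrite /e_ (le_ts 2) ts; case: ifP => // _.
by apply: eq_bigl => p; rewrite le_ts.
Qed.

Lemma invX_le (R : realType) (t s : R) (j : nat) :
  0 < t -> t <= s -> s ^- j <= t ^- j.
Proof.
move=> t0 ts; have s0 := lt_le_trans t0 ts.
by rewrite lef_pV2 ?posrE ?exprn_gt0// lerXn2r// nnegrE ltW.
Qed.

Lemma cvg_invX (R : realType) (t0 : R) (j : nat) : 0 < t0 ->
  t ^- j @[t --> t0] --> t0 ^- j.
Proof.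
move=> t0_gt0; apply: cvgV; first by rewrite expf_neq0// gt_eqF.
exact: exprn_continuous.
Qed.

Lemma near_invX_lt (R : realType) (t0 : R) (j : nat) : 0 < t0 ->
  \forall t \near t0, t ^- j < (Num.truncn (t0 ^- j)).+1%:R.
Proof.
move=> t0_gt0; apply: cvgr_lt (cvg_invX _ _ j t0_gt0) _ _.
exact: truncnS_gt.
Qed.

(** To the left of [t0], [t ^- j] lies above [t0 ^- j], and by continuity below
    the next integer. *)
Lemma near_left_e (R : realType) (t0 : R) (j : nat) : 0 < t0 ->
  \forall t \near t0^'-, e_ j t = e_ j t0.
Proof.
move=> t0_gt0; near=> t.
have t_gt0 : 0 < t by near: t; exact: nbhs_left_gt.
have tt0 : t <= t0 by near: t; exact: nbhs_left_le.
apply: e_truncn => //; apply: truncn_def; apply/andP; split.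
  apply: le_trans (invX_le _ _ _ j t_gt0 tt0).
  by rewrite truncn_le invr_ge0 exprn_ge0// ltW.
by near: t; apply: cvg_within; exact: near_invX_lt.
Unshelve. all: by end_near. Qed.

(** To the right of [t0], [t ^- j] approaches [t0 ^- j] strictly from below for
    [j > 0]: its integer part is that of [t0 ^- j] when this number is not an
    integer, and one less otherwise. *)
Lemma near_right_e (R : realType) (t0 : R) (j : nat) : 0 < t0 ->
  exists c, \forall t \near t0^'+, e_ j t = c.
Proof.
move=> t0_gt0.
suff [n nP] : exists n, \forall t \near t0^'+, Num.truncn (t ^- j) = n.
  (* A reference point s on the right of t0 supplies the constant value of e_ j. *)
  have [s [s0 sn]] : exists s : R, t0 < s /\ Num.truncn (s ^- j) = n.
    apply: (@filter_ex _ t0^'+); near=> s; split; near: s => //.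
    exact: nbhs_right_gt.
  exists (e_ j s); near=> t; apply: e_truncn.
  - by apply: (lt_trans t0_gt0); near: t; exact: nbhs_right_gt.
  - exact: lt_trans s0.
  - by rewrite sn; near: t.
have : 0 <= t0 ^- j by rewrite invr_ge0 exprn_ge0// ltW.
move/truncn_itv; set n := Num.truncn _ => /andP[+ n1].
rewrite le_eqVlt => /predU1P[nE|n_lt].
  case: j @n n1 nE => [|j] n n1 nE.
    by exists 1%N; near=> t; rewrite expr0 invr1 truncn1.
  have n_gt0 : (0 < n)%N by rewrite -(ltr_nat R) nE invr_gt0 exprn_gt0.
  exists n.-1; near=> t; apply: truncn_def; apply/andP; split.
    apply/ltW; near: t; apply: cvg_within.
    apply: cvgr_gt (cvg_invX _ _ j.+1 t0_gt0) _ _.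
    by rewrite -nE ltr_nat prednK.
  have tt0 : t0 < t by near: t; exact: nbhs_right_gt.
  have t_gt0 : 0 < t := lt_trans t0_gt0 tt0.
  by rewrite prednK// nE ltf_pV2 ?posrE ?exprn_gt0// ltrXn2r ?nnegrE ?ltW.
exists n; near=> t; apply: truncn_def; apply/andP; split.
  apply/ltW; near: t; apply: cvg_within.
  exact: cvgr_gt (cvg_invX _ _ j t0_gt0) _ n_lt.
by near: t; apply: cvg_within; exact: near_invX_lt.
Unshelve. all: by end_near. Qed.

Lemma near_right_e_regular (R : realType) (t0 : R) (j : nat) : 0 < t0 ->
  (forall n : nat, t0 ^- j <> n%:R) ->
  \forall t \near t0^'+, e_ j t = e_ j t0.
Proof.
move=> t0_gt0 t0_reg; near=> t.
apply: e_truncn => //.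
  by apply: (lt_trans t0_gt0); near: t; exact: nbhs_right_gt.
apply: truncn_def; apply/andP; split; last first.
  by near: t; apply: cvg_within; exact: near_invX_lt.
apply/ltW; near: t; apply: cvg_within.
apply: cvgr_gt (cvg_invX _ _ j t0_gt0) _ _.
rewrite lt_neqAle truncn_le invr_ge0 exprn_ge0 ?ltW// andbT.
by apply/eqP => tE; exact: (t0_reg _ (esym tE)).
Unshelve. all: by end_near. Qed.

(** * Adherent points of the range of a regulated function *)

(** Quantifying jointly over [t] and [z] gives the form of the local condition that
    near-covering compactness consumes. *)
Lemma near_neq_limit (T : topologicalType) (D : set T) (t0 : T)
    (E : topologicalType) (f : T -> E) (l y : E) :
  hausdorff_space E -> f t @[t --> within D (nbhs t0)] --> l -> l <> y ->
  \forall t \near t0 & z \near y, D t -> f t <> z.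
Proof.
rewrite open_hausdorff => hE fl /eqP /hE [[A B] /= [lA yB] [oA oB AB0]].
exists ([set t | D t -> A (f t)], B); first split => /=.
- by apply: fl; apply: open_nbhs_nbhs; split => //; rewrite -in_setE.
- by apply: open_nbhs_nbhs; split => //; rewrite -in_setE.
- move=> [t z] /= [At Bz] Dt ftz; move/eqP: AB0 => /seteqP[+ _] => /(_ z).
  by apply; split => //; rewrite -ftz; exact: At.
Qed.

(** If [y] is neither a value nor a one-sided limit, then each [t0] in [[a, b]] has
    a neighbourhood on which [f] avoids a neighbourhood of [y]; compactness of
    [[a, b]] makes the neighbourhood of [y] uniform. *)
Lemma closure_image_regulated (R : realType) (E : ptopologicalType)
    (f : R -> E) (a b : R) :
  hausdorff_space E ->
  (forall t0, a < t0 <= b -> cvg (f t @[t --> t0^'-])) ->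
  (forall t0, a <= t0 < b -> cvg (f t @[t --> t0^'+])) ->
  closure (f @` `]a, b[) `<=` f @` `]a, b[ `|`
    ([set lim (f t @[t --> t0^'-]) | t0 in `]a, b]] `|`
     [set lim (f t @[t --> t0^'+]) | t0 in `[a, b[]).
Proof.
move=> hE f_left f_right y y_closure; apply: contrapT => y_out.
suff /y_closure[z [[t /= tab ftz] /(_ t)]] : \forall z \near y,
    `[a, b] `<=` [set t | a < t < b -> f t <> z].
  have {}tab : a < t < b by move: tab; rewrite in_itv.
  by apply=> //; rewrite /= in_itv /=; case/andP: tab => /ltW-> /ltW->.
have /compact_near_coveringP := @segment_compact R a b.
apply => t0 /=; rewrite in_itv/= => /andP[at0 t0b].
have left_ok : \forall t \near t0 & z \near y,
    t < t0 -> a < t < b -> f t <> z.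
  have [->|at0'] := eqVneq t0 a.
    exists (setT, setT); first by split; exact: filterT.
    by move=> [t z] _ /= ta /andP[/(lt_trans ta)]; rewrite ltxx.
  have t0ab : a < t0 <= b by rewrite lt_neqAle eq_sym at0' at0.
  have ly : lim (f t @[t --> t0^'-]) <> y.
    by move=> ly; apply: y_out; right; left; exists t0; rewrite //= in_itv.
  have := near_neq_limit _ _ _ _ _ _ _ hE (f_left _ t0ab) ly.
  by apply: filterS => -[t z] /= tz /tz.
have right_ok : \forall t \near t0 & z \near y,
    t0 < t -> a < t < b -> f t <> z.
  have [->|t0b'] := eqVneq t0 b.
    exists (setT, setT); first by split; exact: filterT.
    by move=> [t z] _ /= bt /andP[_ /(lt_trans bt)]; rewrite ltxx.
  have t0ab : a <= t0 < b by rewrite lt_neqAle t0b' at0.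
  have ly : lim (f t @[t --> t0^'+]) <> y.
    by move=> ly; apply: y_out; right; right; exists t0; rewrite //= in_itv.
  have := near_neq_limit _ _ _ _ _ _ _ hE (f_right _ t0ab) ly.
  by apply: filterS => -[t z] /= tz /tz.
have at_ok : \forall t \near t0 & z \near y,
    t = t0 -> a < t < b -> f t <> z.
  have [t0ab|t0ab] := boolP (a < t0 < b); last first.
    exists (setT, setT); first by split; exact: filterT.
    by move=> [t z] _ /= -> t0ab'; rewrite t0ab' in t0ab.
  have ly : f t0 <> y.
    by move=> ly; apply: y_out; left; exists t0; rewrite //= in_itv.
  have ft0 : f t @[t --> within [set t0] (nbhs t0)] --> f t0.
    move=> A /nbhs_singleton At0; rewrite /= nbhs_filterE /within /=.
    by apply: nearW => t ->.
  have := near_neq_limit _ _ _ _ _ _ _ hE ft0 ly.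
  by apply: filterS => -[t z] /= tz /tz.
apply: filterS3 left_ok at_ok right_ok => -[t z] /= tz1 tz2 tz3.
by case: (ltgtP t t0).
Qed.

(** * One-sided limits of the sum over N_t *)

Lemma dyadic_sum0 (K : numFieldType) (E : normedModType K) (x : nat -> E) :
  dyadic_sum x set0 = 0.
Proof.
rewrite /dyadic_sum; set u := series _.
have -> : u = fun=> 0.
  by apply/funext => n; rewrite /u /series /= big1// => j _; rewrite in_set0.
exact: lim_cst.
Qed.

(** Given [n], take a prime [p > n]. As soon as [t <= 1 / p], every element of
    [N_ t] is at least [e_ 1 t >= p]. *)
Lemma cvg_dyadic_sum_N0 (R : realType) (K : numFieldType)
    (E : completeNormedModType K) (x : nat -> E) :
  dyadic_null K -> (forall u, (0 < u)%N -> `|x u| = 1) ->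
  dyadic_sum x (N_ t) @[t --> (0 : R)^'+] --> (0 : E).
Proof.
move=> null x1; rewrite -[0 in X in _ --> X](dyadic_sum0 _ _ x).
apply: cvg_dyadic_sum => // n.
have [p np p_prime] := prime_above n.
have p_gt0 : 0 < p%:R :> R by rewrite ltr0n prime_gt0.
near=> t; split => // -[j /= j0].
rewrite /f_ big_ltn// => e_n.
have t_gt0 : 0 < t by near: t; exact: nbhs_right_gt.
have p_le : (p <= e_ 1 t)%N.
  apply: e_prime_le => //.
  rewrite expr1 -[leLHS]invrK lef_pV2 ?posrE ?invr_gt0//.
  by near: t; apply: nbhs_right_le; rewrite invr_gt0.
have : (0 < \prod_(2 <= i < j.+1) e_ i t)%N.
  by apply: prodn_gt0 => i; exact: ltnW (e_gt1 _ _ _).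
by move: e_n p_le np; nia.
Unshelve. all: by end_near. Qed.

Lemma cvg_dyadic_sum_N (R : realType) (K : numFieldType)
    (E : completeNormedModType K) (x : nat -> E)
    (F : set_system R) {FF : ProperFilter F} (c : nat -> nat) :
  dyadic_null K -> (forall u, (0 < u)%N -> `|x u| = 1) ->
  (forall j, \forall t \near F, e_ j t = c j) ->
  dyadic_sum x (N_ t) @[t --> F] --> dyadic_sum x (partial_products c).
Proof.
move=> null x1 ec; apply: cvg_dyadic_sum => // n.
by apply: near_partial_products => // t i; exact: e_gt1.
Qed.

Lemma cvg_left_dyadic_sum_N (R : realType) (K : numFieldType)
    (E : completeNormedModType K) (x : nat -> E) (t0 : R) :
  dyadic_null K -> (forall u, (0 < u)%N -> `|x u| = 1) -> 0 < t0 ->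
  dyadic_sum x (N_ t) @[t --> t0^'-] --> dyadic_sum x (N_ t0).
Proof.
move=> null x1 t0_gt0; apply: cvg_dyadic_sum_N => // j.
exact: near_left_e.
Qed.

Lemma is_cvg_right_dyadic_sum_N (R : realType) (K : numFieldType)
    (E : completeNormedModType K) (x : nat -> E) (t0 : R) :
  dyadic_null K -> (forall u, (0 < u)%N -> `|x u| = 1) -> 0 < t0 ->
  cvg (dyadic_sum x (N_ t) @[t --> t0^'+]).
Proof.
move=> null x1 t0_gt0.
have [c cP] := choice (fun j => near_right_e _ _ j t0_gt0).
by apply: cvgP; apply: cvg_dyadic_sum_N cP.
Qed.

(** The functions [e_ j] can only jump here. A jump requires [t ^- j] to be an odd
    prime; allowing any integer keeps the set countable. *)
Definition jump_points (R : realType) : set R :=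
  [set t | 0 < t /\ exists j n : nat, (0 < j)%N /\ t ^- j = n%:R].

(** For fixed [j > 0] and [n], [t ^- j = n] has at most one positive solution. *)
Lemma countable_jump_points (R : realType) : countable (jump_points R).
Proof.
pose S (jn : nat * nat) : set R :=
  [set t | [/\ 0 < t, (0 < jn.1)%N & t ^- jn.1 = jn.2%:R]].
apply: (@sub_countable _ _ _ (\bigcup_(jn in [set: nat * nat]) S jn)).
  apply: subset_card_le => t [t_gt0 [j [n [j_gt0 tjn]]]].
  by exists (j, n).
apply: bigcup_countable => // -[j n] _; case: (pselect (S (j, n) !=set0)).
  move=> [t0 [/= t0_gt0 j_gt0 t0E]].
  apply: (@sub_countable _ _ _ [set t0]); last exact: countable1.
  apply: subset_card_le => t [/= t_gt0 _ tE].
  have /invr_inj/eqP : t ^- j = t0 ^- j by rewrite tE.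
  by rewrite eqrXn2 ?ltW// => /eqP.
by move/nonemptyPn => ->; exact: countable0.
Qed.

Lemma cvg_right_dyadic_sum_N (R : realType) (K : numFieldType)
    (E : completeNormedModType K) (x : nat -> E) (t0 : R) :
  dyadic_null K -> (forall u, (0 < u)%N -> `|x u| = 1) -> 0 < t0 ->
  ~ jump_points R t0 ->
  dyadic_sum x (N_ t) @[t --> t0^'+] --> dyadic_sum x (N_ t0).
Proof.
move=> null x1 t0_gt0 t0_reg; apply: cvg_dyadic_sum_N => // -[|j].
  by apply: nearW => t; rewrite /e_ !expr0.
apply: near_right_e_regular => // n t0n.
by apply: t0_reg; split => //; exists j.+1, n.
Qed.

Lemma countable_setU (T : Type) (A B : set T) :
  countable A -> countable B -> countable (A `|` B).
Proof.
by move=> cA cB; rewrite -bigcup2E; apply: bigcup_countable => // -[|[|n]] _ //=.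
Qed.

Lemma countable_closure_setD_range (R : realType) (K : numFieldType)
    (E : completeNormedModType K) (x : nat -> E) :
  dyadic_null K -> (forall u, (0 < u)%N -> `|x u| = 1) ->
  countable (closure [set dyadic_sum x (N_ t) | t in `]0, (1 : R)[] `\`
             [set dyadic_sum x (N_ t) | t in `]0, (1 : R)[]).
Proof.
move=> null x1; pose f (t : R) := dyadic_sum x (N_ t).
have hE : hausdorff_space E := @norm_hausdorff _ _.
apply: (@sub_countable _ _ _ ([set f 1] `|` ([set 0] `|`
    (fun t0 => lim (f t @[t --> t0^'+])) @` jump_points R))); last first.
  apply: countable_setU; first exact: countable1.
  apply: countable_setU; first exact: countable1.
  exact: sub_countable (card_image_le _ _) (countable_jump_points R).
apply: subset_card_le => y [].
move=> /(closure_image_regulated _ _ _ _ _ hE) [].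
- move=> t0 /andP[t0_gt0 _]; apply: cvgP; exact: cvg_left_dyadic_sum_N.
- move=> t0 /andP[]; rewrite le_eqVlt => /predU1P[<- _|t0_gt0 _].
    by apply: cvgP; exact: cvg_dyadic_sum_N0.
  exact: is_cvg_right_dyadic_sum_N.
- by [].
- move=> [] [t0 /=]; rewrite in_itv /= => /andP[].
  + move=> t0_gt0 t0_le1.
    rewrite (cvg_lim hE (cvg_left_dyadic_sum_N _ _ _ x t0 null x1 t0_gt0)).
    move=> <- y_out; left.
    move: t0_le1; rewrite le_eqVlt => /predU1P[->//|t0_lt1].
    by case: y_out; exists t0; rewrite //= in_itv /= t0_gt0.
  + rewrite le_eqVlt => /predU1P[<- _ <- _|t0_gt0 t0_lt1 <- y_out].
      by right; left; exact: (cvg_lim hE (cvg_dyadic_sum_N0 _ _ _ x null x1)).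
    have [t0_jump|t0_reg] := pselect (jump_points R t0).
      by right; right; exists t0.
    case: y_out; exists t0; first by rewrite /= in_itv /= t0_gt0.
    apply/esym; apply: (cvg_lim hE).
    exact: cvg_right_dyadic_sum_N.
Qed.

(** * Borel measurability *)

Lemma borel_closed (T : topologicalType) (A : set T) : closed A -> borel_set A.
Proof.
move=> cA; rewrite -(setCK A) -setTD; apply: sigma_algebraCD.
by apply: sub_sigma_algebra; exact: closed_openC.
Qed.

Lemma borel_closed_setD_countable (T : ptopologicalType) (F C : set T) :
  hausdorff_space T -> closed F -> countable C -> borel_set (F `\` C).
Proof.
move=> hT cF cC.
pose M := g_sigma_algebraType [set U : set T | open U].
have : measurable ((F : set M) `\` C); last by [].
apply: measurableD; first exact: borel_closed.
apply: countable_measurable => // t; apply: borel_closed.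
by apply: accessible_closed_set1; exact: hausdorff_accessible.
Qed.

Theorem mainTheorem3 (R : realType) (k : scalar_kind)
    (E : completeNormedModType (scalars R k))
    (x : nat -> E) (xs : nat -> {linear E -> (scalars R k)^o})
    (E_infinite : infinite_dimensional E)
    (xs_dual : forall u : nat, (0 < u)%N -> continuous (xs u))
    (x_unit : forall u : nat, (0 < u)%N -> `|x u| = 1)
    (xs_orth : forall u v : nat, (0 < u)%N -> (0 < v)%N -> u <> v ->
       xs v (x u) = 0)
    (xs_diag : forall u : nat, (0 < u)%N -> xs u (x u) <> 0) :
  let range_x : set E :=
    [set dyadic_sum x (N_ t) | t in [set t : R | 0 < t < 1]] in
  [/\ exists F C : set E,
        [/\ closed F, countable C & range_x = F `\` C],
      countable (closure range_x `\` range_x)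
    & borel_set range_x].
Proof.
move=> range_x.
have countable_gap : countable (closure range_x `\` range_x).
  have -> : range_x = [set dyadic_sum x (N_ t) | t in `]0, (1 : R)[].
    apply/seteqP; split => _ [t tab <-]; exists t => //;
    by move: tab; rewrite /= in_itv.
  by apply: countable_closure_setD_range => //; exact: scalars_dyadic_null.
have range_xE : range_x = closure range_x `\` (closure range_x `\` range_x).
  by rewrite setDD; apply/esym/setIidPr; exact: subset_closure.
split => //.
  exists (closure range_x), (closure range_x `\` range_x).
  by split => //; exact: closed_closure.
rewrite range_xE; apply: borel_closed_setD_countable => //.
exact: closed_closure.
Qed.
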